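(* Let $D\ge1$. Let $\underline{X}''\sim\mathrm{CNcDir}^D(\underline{\alpha},\underline{\lambda})$ and $\underline{\tilde X}''\sim\mathrm{CNcDir}^D(\underline{\tilde\alpha},\underline{\tilde\lambda})$, where $\underline{\alpha}=(\alpha_1,\dots,\alpha_{D+1})$, $\underline{\tilde\alpha}=(\tilde\alpha_1,\dots,\tilde\alpha_{D+1})$ have positive entries and $\underline{\lambda}=(\lambda_1,\dots,\lambda_{D+1})$, $\underline{\tilde\lambda}=(\tilde\lambda_1,\dots,\tilde\lambda_{D+1})$ have non-negative entries. Then $\underline{X}''$ and $\underline{\tilde X}''$ have the same distribution if and only if $\underline{\alpha}=\underline{\tilde\alpha}$ and $\underline{\lambda}=\underline{\tilde\lambda}$.
   Context: Notation: $\mathcal S^D=\{\underline{x}\in(0,1)^D:\sum_{i=1}^D x_i<1\}$; $(a)_l=\Gamma(a+l)/\Gamma(a)$; ${}_0F_1(b;x)=\sum_{i\ge0}\frac{1}{(b)_i}\frac{x^i}{i!}$. The Conditional Non-central Dirichlet distribution $\mathrm{CNcDir}^D(\underline{\alpha},\underline{\lambda})$ is the distribution on $\mathcal S^D$ with density, writing $x_{D+1}=1-\sum_{i=1}^D x_i$, $\alpha^+=\sum_{i=1}^{D+1}\alpha_i$, $\lambda^+=\sum_{i=1}^{D+1}\lambda_i$, $$f(\underline{x})=\frac{\Gamma(\alpha^+)}{\prod_{i=1}^{D+1}\Gamma(\alpha_i)}\prod_{i=1}^{D+1}x_i^{\alpha_i-1}\cdot\frac{\prod_{i=1}^{D+1}{}_0F_1\left(\alpha_i;\frac{\lambda_i}{4}x_i\right)}{{}_0F_1\left(\alpha^+;\frac{\lambda^+}{4}\right)}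 .$$ (Equivalently, it is the conditional law of $(Y'_1/Y'^+,\dots,Y'_D/Y'^+)$ given $Y'^+=\sum_{i=1}^{D+1}Y'_i=1$, with independent Non-central Chi-Squared $Y'_i$ having $2\alpha_i$ degrees of freedom and non-centrality $\lambda_i$.) *)

(* Defs.v *)
From HB Require Import structures.
From mathcomp Require Import all_boot all_order all_algebra.
From mathcomp Require Import all_classical all_reals all_analysis.

Set Implicit Arguments.
Unset Strict Implicit.
Unset Printing Implicit Defensive.

Import Order.TTheory GRing.Theory Num.Theory.
Import numFieldNormedType.Exports.

Local Open Scope classical_set_scope.
Local Open Scope ring_scope.

(* Points of R^n are n-tuples, with the product sigma-algebra. The Lebesgue
   measure on R^(n+1) is the image of lebesgue_measure \x lebesgue_tuple n
   under (x, t) |-> x :: t; lebesgue_tuple_box characterises it. *)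
Section lebesgue_tuple.
Context {R : realType}.

Definition tcons n (p : R * n.-tuple R) : n.+1.-tuple R := [tuple of p.1 :: p.2].

Lemma measurable_tcons n : measurable_fun [set: R * n.-tuple R] (@tcons n).
Proof. exact: measurable_cons. Qed.

Section step.
Context (n : nat) (mu : {sigma_finite_measure set (n.-tuple R) -> \bar R}).

Definition lebesgue_cons : set (n.+1.-tuple R) -> \bar R :=
  pushforward (lebesgue_measure \x mu)%E (@tcons n).

HB.instance Definition _ := Measure.copy lebesgue_cons
  (measure_function_pushforward__canonical__measure_function_Measure
    (lebesgue_measure \x mu)%E (@measurable_tcons n)).

Lemma lebesgue_consE (A : set R) (B : set (n.-tuple R)) :
  measurable A -> measurable B ->
  lebesgue_cons [set t | A (thead t) /\ B [tuple of behead t]] =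
  (lebesgue_measure A * mu B)%E.
Proof.
move=> mA mB; rewrite -product_measure1E//; congr ((_ \x _)%E _).
have beheadK (x : R) (t : n.-tuple R) : [tuple of behead (tcons (x, t))] = t.
  exact: val_inj.
by apply/seteqP; split => -[x t] /=; rewrite beheadK theadE.
Qed.

Let lebesgue_cons_sigma_finite : sigma_finite setT lebesgue_cons.
Proof.
have /sigma_finiteP[F [FT Fn Ff]] := sigma_finiteT (@lebesgue_measure R).
have /sigma_finiteP[G [GT Gn Gf]] := sigma_finiteT mu.
exists (fun k => [set t | F k (thead t) /\ G k [tuple of behead t]]).
  apply/seteqP; split => // t _.
  have : [set: R] (thead t) by [].
  rewrite FT => -[i _ Fi].
  have : setT [tuple of behead t] by [].
  rewrite GT => -[j _ Gj].
  exists (maxn i j) => //=; split.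
    by move: (thead t) Fi; apply/subsetPset/Fn/leq_maxl.
  by move: [tuple of behead t] Gj; apply/subsetPset/Gn/leq_maxr.
move=> k; have [mF Foo] := Ff k; have [mG Goo] := Gf k; split.
  apply: measurableI.
    by rewrite -[X in measurable X]setTI; exact: measurable_tnth.
  by rewrite -[X in measurable X]setTI; exact: measurable_behead.
by rewrite lebesgue_consE// lte_mul_pinfty// ge0_fin_numE.
Qed.

HB.instance Definition _ :=
  @Measure_isSigmaFinite.Build _ _ _ lebesgue_cons lebesgue_cons_sigma_finite.

Definition lebesgue_step : {sigma_finite_measure set (n.+1.-tuple R) -> \bar R} :=
  lebesgue_cons.

End step.

Fixpoint lebesgue_tuple n : {sigma_finite_measure set (n.-tuple R) -> \bar R} :=
  if n is m.+1 then lebesgue_step (lebesgue_tuple m) else \d_[tuple].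

Lemma lebesgue_tuple_box n (A : 'I_n -> set R) :
  (forall i, measurable (A i)) ->
  lebesgue_tuple n [set t | forall i, A i (tnth t i)] =
  (\prod_(i < n) lebesgue_measure (A i))%E.
Proof.
elim: n A => [|n IH] A mA.
  by rewrite big_ord0 /= diracE mem_set// => -[].
rewrite big_ord_recl -IH// -lebesgue_consE//; last first.
  have -> : [set t : n.-tuple R | forall i, A (lift ord0 i) (tnth t i)] =
      \bigcap_(i in [set: 'I_n]) [set t | A (lift ord0 i) (tnth t i)].
    by apply/seteqP; split => [t At i _|t At i]; exact: At.
  apply: fin_bigcap_measurable => // i _.
  by rewrite -[X in measurable X]setTI; exact: measurable_tnth.
have tnthE (t : n.+1.-tuple R) i :
    tnth [tuple of behead t] i = tnth t (lift ord0 i).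
  by rewrite [in RHS](tuple_eta t) tnthS.
congr (lebesgue_cons _ _); apply/seteqP; split => t /=.
  by move=> At; split => [|i]; rewrite ?tnthE; exact: At.
move=> [A0 A1] i; have [<-//|/unlift_some[j -> _]] := eqVneq ord0 i.
by have := A1 j; rewrite tnthE.
Qed.

End lebesgue_tuple.

Section cncdir.
Context {R : realType}.

Definition Gamma (a : R) : R :=
  \int[lebesgue_measure]_(x in `]0, +oo[) (x `^ (a - 1) * expR (- x)).

Definition poch (a l : R) : R := Gamma (a + l) / Gamma a.

Definition hyp0F1 (b x : R) : R :=
  limn (series (fun i => (poch b i%:R)^-1 * (x ^+ i / i`!%:R))).

Definition open_simplex D : set (D.-tuple R) :=
  [set x | (forall i, 0 < tnth x i < 1) /\ \sum_(i < D) tnth x i < 1].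

(* appends x_{D+1} = 1 - (x_1 + ... + x_D) *)
Definition complete D (x : D.-tuple R) : D.+1.-tuple R :=
  [tuple of rcons x (1 - \sum_(i < D) tnth x i)].

Definition tsum n (a : n.-tuple R) : R := \sum_(i < n) tnth a i.

Definition cncdir_pdf D (alpha lambda : D.+1.-tuple R) (x : D.-tuple R) : R :=
  Gamma (tsum alpha) / \prod_(i < D.+1) Gamma (tnth alpha i)
  * \prod_(i < D.+1) tnth (complete x) i `^ (tnth alpha i - 1)
  * (\prod_(i < D.+1)
       hyp0F1 (tnth alpha i) (tnth lambda i / 4 * tnth (complete x) i)
     / hyp0F1 (tsum alpha) (tsum lambda / 4)).

Definition is_cncdir D (alpha lambda : D.+1.-tuple R)
    (mu : set (D.-tuple R) -> \bar R) : Prop :=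
  forall A, measurable A ->
    mu A = (\int[lebesgue_tuple D]_(x in A `&` @open_simplex D)
              (cncdir_pdf alpha lambda x)%:E)%E.

End cncdir.

(* Equality on the sigma-algebra only: the values of a measure on
   non-measurable sets are irrelevant. *)
Definition same_distribution {R : realType} d d1 d2 (T : measurableType d)
    (T1 : measurableType d1) (T2 : measurableType d2)
    (P1 : probability T1 R) (P2 : probability T2 R)
    (X1 : {RV P1 >-> T}) (X2 : {RV P2 >-> T}) : Prop :=
  forall A, measurable A -> distribution P1 X1 A = distribution P2 X2 A.

(* Main.v *)
Require Import Defs.
From mathcomp Require Import all_boot all_order all_algebra.
From mathcomp Require Import all_classical all_reals all_analysis.
From mathcomp Require Import measurable_realfun.
From mathcomp Require Import ring lra.

(* Equality in law forces the two densities, which are continuous, to agree at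
   every point of the open simplex. Moving along an edge direction, with
   x_i = t, x_k = s - t and the other coordinates fixed, gives
     c t^(a-1) F(a; l t) (s-t)^(b-1) F(b; m (s-t)) = (the same with primes)
   on (0, s), where F = 0F1. Letting t -> 0 yields a = a'. The powers then
   cancel, and both sides of the remaining identity are real-analytic, so it
   holds for all t < 0 as well. There the second factors are >= 1, hence
   F(a; l t) and F(a; l' t) have the same negative zeros t. Since F(a; .) has a
   negative zero and F(a; 0) = 1, scaling gives l = l'. *)

Set Implicit Arguments.
Unset Strict Implicit.
Unset Printing Implicit Defensive.

Import Order.TTheory GRing.Theory Num.Theory.
Import numFieldNormedType.Exports.

Local Open Scope classical_set_scope.
Local Open Scope ring_scope.

(** * The series 0F1 *)

Section hypergeometric_0F1.
Context {R : realType}.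
Implicit Types (a b x y z : R).

(** Comparing Taylor coefficients at t = 0 would mix l with m and with the unrelated constants c and
    c'; zeros at negative t isolate the first factor and are insensitive to the constants. That such
    a zero exists is classical: F(a; -x) is Gamma(a) x^((1-a)/2) J_(a-1)(2 sqrt x) with J the Bessel
    function. Here it follows by contradiction from two elementary facts, F(a; .)' = F(a+1; .) / a
    and the contiguous relation, which set an exponential upper bound against a polynomial lower
    bound. If l < l', the zeros would be stable under multiplication by l / l' < 1 and accumulate at
    0. The continuation to t < 0 rests on derivative bounds M C^n, without factorials, on each
    compact interval: an interval of zeros then extends to the left by steps of a fixed length. The
    Pochhammer symbols are quotients of Gamma integrals, so finiteness, positivity and the
    functional equation of Gamma are needed to identify the series. *)

Definition rising b i : R := \prod_(j < i) (b + j%:R).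

Definition f01_coeff b i : R := (rising b i * i`!%:R)^-1.

(* [hyp0F1] with its Pochhammer symbols, a priori quotients of integrals,
   written as products; see [hyp0F1E]. *)
Definition f01 b x : R := limn (pseries (f01_coeff b) x).

Lemma rising_gt0 b i : 0 < b -> 0 < rising b i.
Proof. by move=> b0; apply: prodr_gt0 => j _; rewrite ltr_wpDr. Qed.

Lemma risingSl b i : rising b i.+1 = b * rising (b + 1) i.
Proof.
rewrite /rising big_ord_recl addr0; congr (_ * _).
by apply: eq_bigr => j _; rewrite lift0 -nat1r addrA.
Qed.

Lemma risingSr b i : rising b i.+1 = rising b i * (b + i%:R).
Proof. by rewrite /rising big_ord_recr. Qed.

Lemma f01_coeff_gt0 b i : 0 < b -> 0 < f01_coeff b i.
Proof. by move=> b0; rewrite invr_gt0 mulr_gt0 ?rising_gt0// ltr0n fact_gt0. Qed.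

(** The bound equals b / (b + 1), which lies below both 1 and b; the empty product is 1, and any
    other one is b times factors that are at least 1. *)
Lemma rising_ge b i : 0 < b -> (1 + b^-1)^-1 <= rising b i.
Proof.
move=> b0; have b1 : 0 < b^-1 by rewrite invr_gt0.
have i1 : (1 + b^-1)^-1 <= 1 by rewrite invf_le1; lra.
case: i => [|i]; first by rewrite /rising big_ord0.
rewrite risingSl.
have r1 : 1 <= rising (b + 1) i.
  rewrite /rising; elim/big_ind : _ => // [u v u1 v1|j _]; first exact: mulr_ege1.
  by have := ler0n R j; move: b0; lra.
apply: (@le_trans _ _ b); last by rewrite ler_peMr// ltW.
rewrite -[leRHS]invrK lef_pV2 ?posrE//; lra.
Qed.

Lemma f01_coeff_le b i : 0 < b -> f01_coeff b i <= (1 + b^-1) * (i`!%:R)^-1.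
Proof.
move=> b0; have b1 : 0 < b^-1 by rewrite invr_gt0.
rewrite /f01_coeff invfM ler_wpM2r ?invr_ge0//.
rewrite -[leRHS]invrK lef_pV2 ?posrE ?rising_gt0 ?invr_gt0//; last lra.
exact: rising_ge.
Qed.

(** Domination by the exponential series gives both convergence at every x and the growth bound
    [f01_norm]. *)
Lemma f01_norm_le b x i : 0 < b ->
  `|f01_coeff b i * x ^+ i| <= (1 + b^-1) * exp_coeff `|x| i.
Proof.
move=> b0; rewrite normrM normrX gtr0_norm ?f01_coeff_gt0//.
rewrite /exp_coeff/= (mulrC (_ ^+ _)) mulrA ler_wpM2r ?exprn_ge0//.
exact: f01_coeff_le.
Qed.

Lemma seriesM k (f : nat -> R) :
  series (fun i => k * f i) = (fun n => k * series f n).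
Proof. by apply/funext => n; rewrite /series/= mulr_sumr. Qed.

Lemma is_cvg_exp_coeffM b x :
  cvgn (series (fun i => (1 + b^-1) * exp_coeff `|x| i)).
Proof. by rewrite seriesM; apply: is_cvgMr; exact: is_cvg_series_exp_coeff. Qed.

Lemma normed_cvg_f01 b x : 0 < b -> cvgn [normed pseries (f01_coeff b) x].
Proof.
move=> b0; apply: series_le_cvg (@is_cvg_exp_coeffM b x) => // i.
- by rewrite normr_ge0.
- by rewrite mulr_ge0 ?exp_coeff_ge0// addr_ge0// invr_ge0 ltW.
- exact: f01_norm_le.
Qed.

Lemma is_cvg_f01 b x : 0 < b -> cvgn (pseries (f01_coeff b) x).
Proof. by move=> b0; apply: normed_cvg; exact: normed_cvg_f01. Qed.

Lemma f01_norm b x : 0 < b -> `|f01 b x| <= (1 + b^-1) * expR `|x|.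
Proof.
move=> b0; have /lim_series_norm := normed_cvg_f01 (x := x) b0.
move=> /le_trans; apply.
have -> : (1 + b^-1) * expR `|x| =
    limn (series (fun i => (1 + b^-1) * exp_coeff `|x| i)).
  rewrite seriesM; apply/esym/cvg_lim => //.
  by apply: cvgMr; exact: is_cvg_series_exp_coeff.
apply: lim_series_le => //; first exact: normed_cvg_f01.
  exact: is_cvg_exp_coeffM.
by move=> n; exact: f01_norm_le.
Qed.

Lemma f01_ge1 b x : 0 < b -> 0 <= x -> 1 <= f01 b x.
Proof.
move=> b0 x0; have := is_cvg_f01 (x := x) b0; rewrite /f01 => c.
have -> : 1 = pseries (f01_coeff b) x 1.
  by rewrite /pseries/= /series/= big_nat1 /f01_coeff /rising big_ord0 expr0 fact0 !mulr1 invr1.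
apply: nondecreasing_cvgn_le => //; apply: nondecreasing_series => n _ _.
by apply: mulr_ge0; [rewrite ltW// f01_coeff_gt0|exact: exprn_ge0].
Qed.

Lemma f010 b : f01 b 0 = 1.
Proof.
apply: cvg_lim => //; rewrite -cvg_shiftS; apply: cvg_near_cst.
near=> n; rewrite /pseries /series/= big_nat_recl//= big1; last first.
  by move=> i _; rewrite expr0n mulr0.
by rewrite /f01_coeff /rising big_ord0 fact0 expr0 !mulr1 invr1 addr0.
Unshelve. all: by end_near. Qed.

Lemma f01_coeff_diffs b : 0 < b ->
  pseries_diffs (f01_coeff b) = fun i => b^-1 * f01_coeff (b + 1) i.
Proof.
move=> b0; apply/funext => i; rewrite /pseries_diffs /f01_coeff risingSl factS.
have r0 : rising (b + 1) i != 0 by rewrite gt_eqF// rising_gt0// addr_gt0.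
have f0 : i`!%:R != 0 :> R by rewrite pnatr_eq0 -lt0n fact_gt0.
have i0 : 1 + i%:R != 0 :> R by rewrite nat1r pnatr_eq0.
rewrite natrM -nat1r; field; rewrite r0 f0 i0 gt_eqF//.
Qed.

Lemma pseriesZ k (f : nat -> R) x :
  pseries (fun i => k * f i) x = (fun n => k * pseries f x n).
Proof.
apply/funext => n; rewrite /pseries /series/= mulr_sumr.
by apply: eq_bigr => i _; rewrite mulrA.
Qed.

(** Termwise differentiation shifts the parameter from b to b + 1, so derivatives of all orders stay
    in the family. *)
Lemma is_derive_f01 b x : 0 < b ->
  is_derive x 1 (f01 b) (b^-1 * f01 (b + 1) x).
Proof.
move=> b0; have b1 : 0 < b + 1 by rewrite addr_gt0.
have b2 : 0 < b + 1 + 1 by rewrite addr_gt0.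
have cZ k c : 0 < c -> cvgn (pseries (fun i => k * f01_coeff c i) (`|x| + 1)).
  by move=> c0; rewrite pseriesZ; apply: is_cvgMr; exact: is_cvg_f01.
have -> : b^-1 * f01 (b + 1) x = limn (pseries (pseries_diffs (f01_coeff b)) x).
  rewrite f01_coeff_diffs// pseriesZ; apply/esym/cvg_lim => //.
  by apply: cvgMr; exact: is_cvg_f01.
apply: (@pseries_snd_diffs _ _ (`|x| + 1)); first exact: is_cvg_f01.
- by rewrite f01_coeff_diffs//; exact: cZ.
- have -> : pseries_diffs (pseries_diffs (f01_coeff b)) =
     fun i => b^-1 * (b + 1)^-1 * f01_coeff (b + 1 + 1) i.
    rewrite f01_coeff_diffs//; apply/funext => i.
    rewrite [LHS]/pseries_diffs mulrCA -mulrA.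
    by have /(congr1 (fun f => f i)) := f01_coeff_diffs b1; rewrite [LHS]/pseries_diffs => ->.
  exact: cZ.
- by rewrite [ltRHS]ger0_norm ?ltrDl// addr_ge0.
Qed.

Lemma continuous_f01 b : 0 < b -> continuous (f01 b).
Proof.
move=> b0 x; apply: differentiable_continuous; apply/derivable1_diffP.
by have [] := is_derive_f01 x b0.
Qed.

(* This is the differential equation z w'' + a w' = w satisfied by w = 0F1(a; z). *)
Lemma f01_contiguous a z : 0 < a ->
  f01 a z = f01 (a + 1) z + z / (a * (a + 1)) * f01 (a + 1 + 1) z.
Proof.
move=> a0; have a1 : 0 < a + 1 by rewrite addr_gt0.
have a2 : 0 < a + 1 + 1 by rewrite addr_gt0.
apply: cvg_lim => //; rewrite -cvg_shiftS.
(* The factor z raises degrees by one, so n + 1 terms on the left match n + 1 terms of the first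
   series and n terms of the second. *)
have -> : [sequence pseries (f01_coeff a) z n.+1]_n =
   (fun n => pseries (f01_coeff (a + 1)) z n.+1 +
      z / (a * (a + 1)) * pseries (f01_coeff (a + 1 + 1)) z n).
  apply/funext => n; rewrite /pseries /series/=.
  rewrite big_nat_recl// [in RHS]big_nat_recl//= -addrA mulr_sumr -big_split/=.
  rewrite /f01_coeff; congr (_ + _); first by rewrite /rising !big_ord0.
  apply: eq_bigr => i _.
  have q0 : a + (i%:R + 1) != 0 by rewrite gt_eqF// natr1 ltr_wpDr.
  have -> : rising a i.+1 = a * (a + 1) * rising (a + 1 + 1) i / (a + (i%:R + 1)).
    apply: (canRL (mulfK q0)).
    by rewrite natr1 -risingSr risingSl risingSl mulrA.
  have r0 : rising (a + 1 + 1) i != 0 by rewrite gt_eqF// rising_gt0.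
  have f0 : i`!%:R != 0 :> R by rewrite pnatr_eq0 -lt0n fact_gt0.
  have i0 : i%:R + 1 != 0 :> R by rewrite natr1 pnatr_eq0.
  rewrite risingSl factS natrM -natr1 exprS; field.
  by rewrite q0 r0 f0 i0 !gt_eqF.
apply: cvgD; first by rewrite (cvg_shiftS (pseries _ _)); exact: is_cvg_f01.
by apply: cvgMr; exact: is_cvg_f01.
Qed.

End hypergeometric_0F1.

(** * An identity principle for real-analytic functions *)

Section calculus.
Context {R : realType}.
Implicit Types (f g df : R -> R) (a b x y : R).

Lemma is_derive_affine f k c x d :
  is_derive (k * x + c) 1 f d ->
  is_derive x 1 (fun y => f (k * y + c)) (k * d).
Proof.
move=> fd.
have gd : is_derive x 1 (fun y => k * y + c) k.
  have : is_derive x 1 (k \*: (@idfun R) + cst c) (k *: 1 + 0) by apply: is_deriveD.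
  by rewrite addr0 [k *: _]mulr1.
by rewrite mulrC; exact: (@is_derive1_comp _ f (fun y => k * y + c)).
Qed.

Lemma is_derive_continuous f x (d : R) : is_derive x 1 f d -> {for x, continuous f}.
Proof. by case=> fd _; apply: differentiable_continuous; apply/derivable1_diffP. Qed.

Lemma is_derive_ler f df a b : a <= b ->
  (forall x, a <= x <= b -> is_derive x 1 f (df x)) ->
  (forall x, a <= x <= b -> 0 <= df x) -> f a <= f b.
Proof.
move=> ab fd df0.
have fc : {within `[a, b], continuous f}.
  apply: derivable_within_continuous => x; rewrite in_itv => /fd[].
  by [].
have fd' x : x \in `]a, b[ -> is_derive x 1 f (df x).
  by rewrite in_itv/= => /andP[/ltW ax /ltW xb]; apply: fd; rewrite ax.
have [x] := MVT_segment ab fd' fc.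
by rewrite in_itv/= => /df0 d0 e; rewrite -subr_ge0 e mulr_ge0 ?subr_ge0.
Qed.

End calculus.

Section identity_principle.
Context {R : realType}.
Implicit Types (f g h : R -> R) (L C M c x : R) (n : nat).

(* On [-L, L], the m-th derivative is bounded by M C^m for every m <= n. This
   growth condition is preserved by products and affine substitutions without
   any recentering of power series, and forces analyticity. *)
Fixpoint tame L C M n h : Prop :=
  (forall x, `|x| <= L -> `|h x| <= M) /\
  if n is n'.+1 then
    exists2 h', (forall x, is_derive x 1 h (h' x)) & tame L C (M * C) n' h'
  else True.

Lemma tame_bound L C M n h x : tame L C M n h -> `|x| <= L -> `|h x| <= M.
Proof. by case: n => [|n] [hM _]; exact: hM. Qed.

Lemma tameW L C C' M M' n h : 0 <= M -> 0 <= C -> C <= C' -> M <= M' ->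
  tame L C M n h -> tame L C' M' n h.
Proof.
move=> M0 C0 CC'; elim: n M M' h M0 => [|n IH] M M' h M0 MM' [hM hd].
  by split=> // x /hM /le_trans; apply.
split=> [x /hM /le_trans|]; first exact.
have [h' h'd th'] := hd; exists h' => //.
by apply: IH th'; rewrite ?mulr_ge0 ?ler_pM.
Qed.

Lemma tamePred L C M n h : tame L C M n.+1 h -> tame L C M n h.
Proof.
elim: n M h => [|n IH] M h [hM [h' h'd th']]; first by split.
by split => //; exists h' => //; exact: IH.
Qed.

Lemma tameD L C M1 M2 n f g : tame L C M1 n f -> tame L C M2 n g ->
  tame L C (M1 + M2) n (fun x => f x + g x).
Proof.
elim: n M1 M2 f g => [|n IH] M1 M2 f g [fM fd] [gM gd].
  by split=> // x xL; rewrite (le_trans (ler_normD _ _))// lerD ?fM ?gM.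
split=> [x xL|]; first by rewrite (le_trans (ler_normD _ _))// lerD ?fM ?gM.
have [[f' f'd tf'] [g' g'd tg']] := (fd, gd).
exists (fun x => f' x + g' x); first by move=> x; exact: is_deriveD.
by rewrite mulrDl; exact: IH.
Qed.

Lemma tameZ L C M n k f : tame L C M n f -> tame L C (`|k| * M) n (fun x => k * f x).
Proof.
elim: n M f => [|n IH] M f [fM fd].
  by split=> // x xL; rewrite normrM ler_wpM2l// fM.
split=> [x xL|]; first by rewrite normrM ler_wpM2l// fM.
have [f' f'd tf'] := fd.
exists (fun x => k * f' x); first by move=> x; exact: is_deriveZ.
by rewrite -mulrA; exact: IH.
Qed.

(** Leibniz rule: the bounds M1 (M2 C2) of f g' and (M1 C1) M2 of f' g add up to M1 M2 (C1 + C2),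
    which is why the rates add. *)
Lemma tameM L C1 C2 M1 M2 n f g : tame L C1 M1 n f -> tame L C2 M2 n g ->
  tame L (C1 + C2) (M1 * M2) n (fun x => f x * g x).
Proof.
elim: n M1 M2 f g => [|n IH] M1 M2 f g tf tg.
  by split=> // x xL; rewrite normrM ler_pM// (tame_bound tf, tame_bound tg).
split=> [x xL|]; first by rewrite normrM ler_pM// (tame_bound tf, tame_bound tg).
have [[_ [f' f'd tf']] [_ [g' g'd tg']]] := (tf, tg).
exists (fun x => f x * g' x + f' x * g x).
  by move=> x; apply: is_derive_eq; rewrite /GRing.scale/= (mulrC (f' x)).
have -> : M1 * M2 * (C1 + C2) = M1 * (M2 * C2) + M1 * C1 * M2 by ring.
by apply: tameD; apply: IH => //; exact: tamePred.
Qed.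

Lemma tame_affine L L' C M n k c f : `|k| * L + `|c| <= L' ->
  tame L' C M n f -> tame L (`|k| * C) M n (fun x => f (k * x + c)).
Proof.
move=> LL'; have u x : `|x| <= L -> `|k * x + c| <= L'.
  move=> xL; rewrite (le_trans (ler_normD _ _))// (le_trans _ LL')// lerD2r.
  by rewrite normrM ler_wpM2l.
elim: n M f => [|n IH] M f [fM fd].
  by split=> // x /u; exact: fM.
split=> [x /u|]; first exact: fM.
have [f' f'd tf'] := fd.
exists (fun x => k * f' (k * x + c)); first by move=> x; exact: is_derive_affine.
by rewrite mulrCA; apply: tameZ; exact: IH.
Qed.

Lemma is_derive_eq0 f df c d x : c < x < d ->
  (forall y, c < y < d -> f y = 0) -> is_derive x 1 f df -> df = 0.
Proof.
move=> cxd f0 fd.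
have : is_derive x 1 f 0.
  apply: (@near_eq_is_derive _ _ _ (cst 0)).
  near=> y; apply/esym/f0.
  have : y \in `]c, d[ by near: y; apply: near_in_itvoo; rewrite in_itv.
  by rewrite in_itv.
by case: fd => _ <- [_ <-].
Unshelve. all: by end_near. Qed.

(** All derivatives vanish at e, and each use of the mean value theorem between x and e gains a
    factor C (e - x). This is Taylor's estimate without the factorial; it tends to 0 as soon as C (e
    - x) < 1. *)
Lemma tame_vanish_bound L C M n h c d e x : 0 <= C -> 0 <= M ->
  c < e < d -> -L <= x <= e -> e <= L ->
  (forall y, c < y < d -> h y = 0) -> tame L C M n h ->
  `|h x| <= M * (C * (e - x)) ^+ n.
Proof.
move=> C0 + ced + eL; elim: n M h x => [|n IH] M h x M0 /andP[Lx xe] h0 th.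
  by rewrite expr0 mulr1 (tame_bound th)// ler_norml Lx (le_trans xe).
have [_ [h' h'd th']] := th.
have hc : {within `[x, e], continuous h}.
  by apply: derivable_within_continuous => y _; have [] := h'd y.
have [y] := MVT_segment xe (fun y _ => h'd y) hc.
rewrite in_itv/= => /andP[xy ye]; rewrite (h0 e)// sub0r => /(congr1 Num.norm).
rewrite normrN => ->; rewrite normrM (@ger0_norm _ (e - x)) ?subr_ge0//.
apply: (@le_trans _ _ (M * C * (C * (e - y)) ^+ n * (e - x))).
  rewrite ler_wpM2r ?subr_ge0//; apply: IH => //.
  - by rewrite mulr_ge0.
  - by rewrite (le_trans Lx xy).
  - by move=> z zcd; apply: is_derive_eq0 (h'd z); [exact: zcd|].
rewrite exprS [leRHS](_ : _ = M * C * (C * (e - x)) ^+ n * (e - x)); last by ring.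
rewrite ler_wpM2r ?subr_ge0// ler_wpM2l ?mulr_ge0// lerXn2r ?nnegrE ?mulr_ge0 ?subr_ge0//.
by rewrite ler_wpM2l// lerD2l lerN2.
Qed.

Lemma tame_vanish_step L C M h c d e x : 0 <= C -> 0 <= M ->
  c < e < d -> -L <= x <= e -> e <= L -> C * (e - x) <= 2^-1 ->
  (forall y, c < y < d -> h y = 0) -> (forall n, tame L C M n h) ->
  h x = 0.
Proof.
move=> C0 M0 ced xe eL Cex h0 th; apply/eqP; rewrite -normr_le0.
have /cvg_lim <- // : (fun n => M * 2^-1 ^+ n) @ \oo --> (0 : R).
  rewrite -[X in _ --> X](mulr0 M); apply: cvgMr.
  by apply: cvg_expr; rewrite ger0_norm// invf_lt1// ltr1n.
apply: limr_ge.
  apply: is_cvgMr; apply/cvg_ex; exists 0.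
  by apply: cvg_expr; rewrite ger0_norm// invf_lt1// ltr1n.
near=> n; apply: le_trans (tame_vanish_bound C0 M0 ced xe eL h0 (th n)) _.
case/andP: xe => _ xe.
by rewrite ler_wpM2l// lerXn2r ?nnegrE ?mulr_ge0 ?subr_ge0.
Unshelve. all: by end_near. Qed.

(** C is uniform on [-L, L], so the interval of zeros grows to the left by the same r at each step
    and reaches x after finitely many. *)
Lemma tame_vanish L C M h c d x : 0 <= C -> 0 <= M -> c < d -> d <= L ->
  (forall y, c < y < d -> h y = 0) -> (forall n, tame L C M n h) ->
  -L <= x < d -> h x = 0.
Proof.
move=> C0 M0 cd dL h0 th /andP[Lx xd].
(* The expansion point lies at most r to the right of the current left end c', the target less than
   r to its left: the distance is at most 2 r, and C (2 r) <= 1/2. Adding 1 to C covers C = 0. *)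
pose r : R := (4 * (C + 1))^-1.
have r0 : 0 < r by rewrite invr_gt0; lra.
have Cr : C * (2 * r) <= 2^-1.
  rewrite (_ : C * (2 * r) = C / (C + 1) * 2^-1); last first.
    by rewrite /r; field; rewrite gt_eqF//; lra.
  by rewrite ler_piMl// ler_pdivrMr; lra.
suff H (m : nat) : forall y : R, -L <= y -> c - r *+ m < y < d -> h y = 0.
  have [k hk] : exists k, (c - x) / r < k%:R.
    by exists (Num.truncn ((c - x) / r)).+1; exact: truncnS_gt.
  apply: (H k) => //; rewrite xd andbT -mulr_natr.
  by move: hk; rewrite ltr_pdivrMr//; lra.
elim: m => [|k IH] y Ly; first by rewrite mulr0n subr0; exact: h0.
move=> /andP[+ yd]; have [ky _|yk] := ltP (c - r *+ k) y.
  by apply: IH => //; rewrite ky.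
set c' := c - r *+ k in yk IH; rewrite mulrSr opprD addrA -/c' => ky.
have c'd : c' < d by rewrite (le_lt_trans _ cd)// gerBl mulrn_wge0// ltW.
have [rd|dr] := ltP (c' + r) d.
  apply: (@tame_vanish_step L C M h c' d (c' + r)) => //; [lra|lra|lra| |].
    by rewrite (le_trans _ Cr)// ler_wpM2l//; lra.
  by move=> z /andP[c'z zd]; apply: IH; [lra|rewrite c'z].
apply: (@tame_vanish_step L C M h c' d ((c' + d) / 2)) => //; [lra|lra|lra| |].
  by rewrite (le_trans _ Cr)// ler_wpM2l//; lra.
by move=> z /andP[c'z zd]; apply: IH; [lra|rewrite c'z].
Qed.

(** M and C may depend on L but not on the order n. This growth is stricter than analyticity, which
    would allow n!, and it makes the step length in [tame_vanish] uniform. *)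
Definition entire h := forall L, 0 <= L ->
  exists M C, [/\ 0 <= M, 0 <= C & forall n, tame L C M n h].

Lemma entireD f g : entire f -> entire g -> entire (fun x => f x + g x).
Proof.
move=> ef eg L L0; have [M1 [C1 [M10 C10 tf]]] := ef L L0.
have [M2 [C2 [M20 C20 tg]]] := eg L L0.
exists (M1 + M2), (C1 + C2); split; rewrite ?addr_ge0// => n.
by apply: tameD; [apply: tameW (tf n)|apply: tameW (tg n)]; rewrite ?lerDl ?lerDr.
Qed.

Lemma entireM f g : entire f -> entire g -> entire (fun x => f x * g x).
Proof.
move=> ef eg L L0; have [M1 [C1 [M10 C10 tf]]] := ef L L0.
have [M2 [C2 [M20 C20 tg]]] := eg L L0.
by exists (M1 * M2), (C1 + C2); split; rewrite ?addr_ge0 ?mulr_ge0// => n; exact: tameM.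
Qed.

Lemma entireZ k f : entire f -> entire (fun x => k * f x).
Proof.
move=> ef L L0; have [M [C [M0 C0 tf]]] := ef L L0.
by exists (`|k| * M), C; split; rewrite ?mulr_ge0// => n; exact: tameZ.
Qed.

Lemma entire_affine k c f : entire f -> entire (fun x => f (k * x + c)).
Proof.
move=> ef L L0; have L'0 : 0 <= `|k| * L + `|c| by rewrite addr_ge0// mulr_ge0.
have [M [C [M0 C0 tf]]] := ef _ L'0.
exists M, (`|k| * C); split; rewrite ?mulr_ge0// => n.
exact: tame_affine (tf n).
Qed.

Lemma entire_vanish h c d x : entire h -> c < d ->
  (forall y, c < y < d -> h y = 0) -> x < d -> h x = 0.
Proof.
move=> eh cd h0 xd.
have [M [C [M0 C0 th]]] := eh (`|x| + `|d|) (addr_ge0 (normr_ge0 _) (normr_ge0 _)).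
apply: tame_vanish C0 M0 cd _ h0 th _; first by rewrite ler_wpDl// ler_norm.
have := ler_norm (- x); rewrite normrN => nx.
by have := normr_ge0 d; lra.
Qed.

(** Each differentiation multiplies by c^-1 and moves c to c + 1. The induction therefore runs over
    all c >= b at once: there c^-1 <= b^-1, and the constant 1 + c^-1 only decreases. *)
Lemma entire_f01 b : 0 < b -> entire (f01 b).
Proof.
move=> b0 L L0; have bV : 0 < b^-1 by rewrite invr_gt0.
exists ((1 + b^-1) * expR L), b^-1.
split; first by rewrite mulr_ge0 ?expR_ge0//; lra.
  exact: ltW.
suff H n : forall c, b <= c -> tame L b^-1 ((1 + c^-1) * expR L) n (f01 c).
  by move=> n; exact: H.
elim: n => [|n IH] c bc.
all: have c0 : 0 < c by exact: lt_le_trans bc.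
all: have cV : 0 < c^-1 by rewrite invr_gt0.
all: have bd x : `|x| <= L -> `|f01 c x| <= (1 + c^-1) * expR L.
1,3: by move=> xL; rewrite (le_trans (f01_norm _ c0))// ler_wpM2l ?ler_expR//; lra.
  by split.
split=> //; exists (fun x => c^-1 * f01 (c + 1) x) => [x|].
  exact: is_derive_f01.
have c1V : 0 < (c + 1)^-1 by rewrite invr_gt0; lra.
have cc1 : (c + 1)^-1 <= c^-1 by rewrite lef_pV2 ?posrE; lra.
have cb : c^-1 <= b^-1 by rewrite lef_pV2 ?posrE.
have e0 := expR_gt0 L.
have bc1 : b <= c + 1 by lra.
have := @tameZ L b^-1 _ n c^-1 _ (IH (c + 1) bc1).
rewrite gtr0_norm//; apply: tameW => //; [|exact: ltW|].
  by apply: mulr_ge0; [exact: ltW|apply: mulr_ge0; [lra|exact: ltW]].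
rewrite [leRHS]mulrC; apply: ler_pM => //; [exact: ltW|by apply: mulr_ge0; [lra|exact: ltW]|].
by apply: ler_wpM2r; [exact: ltW|lra].
Qed.

End identity_principle.

(** * Negative zeros of 0F1 *)

Section negative_zeros.
Context {R : realType}.
Implicit Types (a b c l m s t x y z : R).

Lemma is_derive_f01N a x : 0 < a ->
  is_derive x 1 (fun y => f01 a (- y)) (- (a^-1 * f01 (a + 1) (- x))).
Proof.
move=> a0; have E b y : f01 b (- y) = f01 b (-1 * y + 0) by rewrite mulN1r addr0.
rewrite (_ : (fun y => f01 a (- y)) = fun y => f01 a (-1 * y + 0)); last first.
  by apply/funext => y; exact: E.
by rewrite E -[- (a^-1 * _)]mulN1r; apply: is_derive_affine; exact: is_derive_f01.
Qed.

Lemma is_derive_powRM a (g : R -> R) x (dg : R) : 0 < x -> 0 < a ->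
  is_derive x 1 g dg ->
  is_derive x 1 (fun y => y `^ a * g y) (x `^ (a - 1) * (x * dg + a * g x)).
Proof.
move=> x0 a0 gd; have pd := is_derive1_powR a x0.
apply: is_derive_eq; rewrite /GRing.scale/= -(mulr_powRB1 (ltW x0) a0).
ring.
Qed.

(** By [f01_contiguous], the derivative of z^a F(a+1; -z) is a z^(a-1) F(a; -z), which is positive
    under the hypothesis. *)
Lemma powR_f01N_ler a x y : 0 < a -> (forall z, 0 < z -> 0 < f01 a (- z)) ->
  0 < x <= y -> x `^ a * f01 (a + 1) (- x) <= y `^ a * f01 (a + 1) (- y).
Proof.
move=> a0 w0 /andP[x0 xy]; have a1 : 0 < a + 1 by rewrite addr_gt0.
apply: (@is_derive_ler _ (fun z => z `^ a * f01 (a + 1) (- z))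
  (fun z => z `^ (a - 1) * (a * f01 a (- z)))) => // z /andP[xz _].
  have z0 : 0 < z by exact: lt_le_trans xz.
  have := is_derive_powRM z0 a0 (is_derive_f01N z a1).
  congr (is_derive _ _ _ _); congr (_ * _).
  rewrite [in RHS]f01_contiguous//; field.
  by rewrite !gt_eqF.
have z0 : 0 < z by exact: lt_le_trans xz.
by rewrite !mulr_ge0 ?powR_ge0 ?ltW ?w0.
Qed.

(** The function z^a F(a+1; -z) is nondecreasing, and positive near 0 on the right because F(a+1; 0)
    = 1. Positivity thus passes from a to a + 1, and can be iterated. *)
Lemma f01N_succ_gt0 a x : 0 < a -> (forall z, 0 < z -> 0 < f01 a (- z)) ->
  0 < x -> 0 < f01 (a + 1) (- x).
Proof.
move=> a0 w0 x0; have a1 : 0 < a + 1 by rewrite addr_gt0.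
have [y /andP[y0 yx] wy] : exists2 y, 0 < y <= x & 0 < f01 (a + 1) (- y).
  have c0 : {for 0, continuous (fun y => f01 (a + 1) (- y))}.
    exact: is_derive_continuous (is_derive_f01N 0 a1).
  near (0 : R)^'+ => y; exists y.
    by apply/andP; split => //; near: y; exact: nbhs_right_le.
  near: y; apply: cvg_within; apply: (cvgr_gt _ c0).
  by rewrite oppr0 f010.
have := powR_f01N_ler a0 w0 (introT andP (conj y0 yx)).
move=> /(lt_le_trans _) => /(_ 0); rewrite mulr_gt0 ?powR_gt0// => /(_ isT).
by rewrite pmulr_rgt0 ?powR_gt0.
Unshelve. all: by end_near. Qed.

(* If w(x) = 0F1(a; -x) had no zero, then w <= exp(-x / a), whereas x^a w'(x)
   is negative and decreasing, so that w(x) >= w(x) - w(2x) >= K x^(1-a). *)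
Lemma f01_root a : 0 < a -> exists2 x, 0 < x & f01 a (- x) = 0.
Proof.
move=> a0; have a1 : 0 < a + 1 by rewrite addr_gt0.
have a2 : 0 < a + 1 + 1 by rewrite addr_gt0.
apply: contrapT => nx.
have w0 x : 0 < x -> 0 < f01 a (- x).
  move=> x0; rewrite ltNge; apply/negP => wle0.
  have [|||c] := @IVT R (f01 a) (- x) 0 0.
  - by rewrite oppr_le0 ltW.
  - by apply: continuous_subspaceT; exact: continuous_f01.
  - by rewrite f010 ge_min wle0 le_max ler01 orbT.
  rewrite in_itv/= => /andP[xc c0] fc; apply: nx; exists (- c); last by rewrite opprK.
  rewrite oppr_gt0 lt_neqAle c0 andbT; apply/eqP => c00.
  by move: fc; rewrite c00 f010 => /eqP; rewrite oner_eq0.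
have w1 x : 0 < x -> 0 < f01 (a + 1) (- x) by exact: f01N_succ_gt0.
have w2 x : 0 < x -> 0 < f01 (a + 1 + 1) (- x) by exact: f01N_succ_gt0.
have ww1 x : 0 <= x -> f01 a (- x) <= f01 (a + 1) (- x).
  rewrite le_eqVlt => /predU1P[<-|x0]; first by rewrite oppr0 !f010.
  rewrite f01_contiguous// gerDl mulNr mulNr oppr_le0.
  by rewrite mulr_ge0 ?ltW ?w2// divr_gt0// mulr_gt0.
(* The left side is 1 at x = 0 and its derivative is exp(x/a)/a times F(a; -x) - F(a+1; -x),
   nonpositive by [ww1]. *)
have ub x : 0 < x -> expR (x / a) * f01 a (- x) <= 1.
  move=> x0.
  have := @is_derive_ler _ (fun z => - (expR (z / a) * f01 a (- z)))
    (fun z => expR (z / a) / a * (f01 (a + 1) (- z) - f01 a (- z))) 0 x (ltW x0).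
  rewrite mul0r expR0 oppr0 f010 mulr1 lerN2; apply => z /andP[z0 _].
    have ed : is_derive z 1 (fun y => expR (a^-1 * y + 0)) (a^-1 * expR (a^-1 * z + 0)).
      exact: is_derive_affine.
    have -> : (fun y => - (expR (y / a) * f01 a (- y))) =
        - ((fun y => expR (a^-1 * y + 0)) * (fun y => f01 a (- y))).
      by apply/funext => y; rewrite (mulrC y) -[a^-1 * y]addr0.
    have wd := is_derive_f01N z a0.
    apply: is_derive_eq; rewrite /GRing.scale/= addr0 (mulrC z); ring.
  rewrite mulr_ge0 ?subr_ge0 ?ww1// mulr_ge0 ?expR_ge0// invr_ge0.
  exact: ltW.
pose c := f01 (a + 1) (- 1).
have c0 : 0 < c by exact: w1.
(* On [x, 2x] the slope -w' = F(a+1; -z) / a is at least c / (a z^a) by monotonicity from z = 1,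
   hence at least k. Integrating over length x and dropping w(2x) > 0 gives the bound. *)
have lb x : 1 <= x -> x * (c / (a * (2 * x) `^ a)) <= f01 a (- x).
  move=> x1; set k := c / _.
  have x0 : 0 < x by lra.
  have p0 : 0 < (2 * x) `^ a by rewrite powR_gt0//; lra.
  have xx : x <= 2 * x by lra.
  suff H : - f01 a (- x) - k * x <= - f01 a (- (2 * x)) - k * (2 * x).
    by have := w0 (2 * x); lra.
  apply: (@is_derive_ler _ (fun z => - f01 a (- z) - k * z)
    (fun z => a^-1 * f01 (a + 1) (- z) - k) x (2 * x) xx) => z /andP[xz zx].
    have wd := is_derive_f01N z a0.
    have kd : is_derive z 1 (fun y => k * y) k.
      by have := is_deriveZ k (is_derive_id z (1 : R)); rewrite [k *: _]mulr1.
    by have := is_deriveB (is_deriveN wd) kd; rewrite opprK.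
  have z0 : 0 < z by lra.
  have z1 : 0 < (1 : R) <= z by rewrite ltr01; lra.
  have := powR_f01N_ler a0 w0 z1; rewrite powR1 mul1r -/c => cz.
  rewrite subr_ge0 /k invfM mulrCA ler_wpM2l ?invr_ge0 ?(ltW a0)//.
  rewrite ler_pdivrMr// (le_trans cz)// mulrC ler_wpM2l ?(ltW (w1 _ z0))//.
  by rewrite ge0_ler_powR ?nnegrE ?(ltW a0)//; lra.
have [N aN] : exists N : nat, a <= N.+1%:R.
  by exists (Num.truncn a); rewrite ltW// truncnS_gt.
(* With exp(x/a) replaced by its Taylor term of order N + 1 and (2x)^a by (2x)^(N+1), the product of
   the two lower bounds is exactly x / K; the choice x = 1 + K makes it exceed 1, against [ub]. *)
pose K := a * 2 ^+ N.+1 * a ^+ N.+1 * N.+1`!%:R / c.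
have K0 : 0 < K by rewrite !mulr_gt0 ?exprn_gt0 ?invr_gt0// ltr0n fact_gt0.
pose x := 1 + K.
have x1 : 1 <= x by rewrite lerDl ltW.
have x0 : 0 < x by lra.
have f0 : 0 < N.+1`!%:R :> R by rewrite ltr0n fact_gt0.
have := ub _ x0; apply/negP; rewrite -ltNge.
have e1 : (x / a) ^+ N.+1 / N.+1`!%:R <= expR (x / a).
  by apply: le_trans (expR_ge1Dxn N _); rewrite ?lerDr// divr_ge0 ?ltW.
have p1 : (2 * x) `^ a <= (2 * x) ^+ N.+1.
  by rewrite -powR_mulrn ?ler_powR//; lra.
have p0 : 0 < (2 * x) `^ a by rewrite powR_gt0//; lra.
apply: (@lt_le_trans _ _ ((x / a) ^+ N.+1 / N.+1`!%:R *
    (x * (c / (a * (2 * x) ^+ N.+1))))); last first.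
  apply: ler_pM => //.
  - by rewrite divr_ge0 ?exprn_ge0 ?divr_ge0 ?(ltW x0) ?(ltW a0).
  - apply: mulr_ge0 (ltW x0) _; apply: divr_ge0 (ltW c0) _.
    by apply: mulr_ge0 (ltW a0) _; apply: exprn_ge0; lra.
  - apply: le_trans (lb _ x1); apply: ler_wpM2l (ltW x0) _ _ _.
    apply: ler_wpM2l (ltW c0) _ _ _.
    have q0 : 0 < (2 * x) ^+ N.+1 by apply: exprn_gt0; lra.
    by rewrite lef_pV2 ?posrE ?mulr_gt0// ler_wpM2l ?(ltW a0).
have -> : (x / a) ^+ N.+1 / N.+1`!%:R * (x * (c / (a * (2 * x) ^+ N.+1))) = x / K.
  rewrite /K !exprMn exprVn; field.
  by rewrite !gt_eqF ?exprn_gt0.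
by rewrite ltr_pdivlMr// mul1r /x ltrDr.
Qed.

(** If l < l' and F(a; -x) = 0, then t = -x / l' shows that -x l / l' is a zero too. Iteration gives
    zeros tending to 0, against continuity and F(a; 0) = 1. The case l = 0 reaches 0 in one step. *)
Lemma f01_root_scale a l l' : 0 < a -> 0 <= l -> 0 <= l' ->
  (forall t, t < 0 -> f01 a (l * t) = 0 <-> f01 a (l' * t) = 0) -> l = l'.
Proof.
move=> a0; wlog : l l' / l < l'.
  move=> H l0 l'0 e; have [ll'|ll'|//] := ltgtP l l'; first exact: H.
  by apply/esym; apply: H ll' l'0 l0 _ => t t0; apply: iff_sym; exact: e.
move=> ll' l0 l'0 e; exfalso.
have [x x0 fx] := f01_root a0.
have l'p : 0 < l' by exact: le_lt_trans ll'.
pose r := l / l'.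
have r0 : 0 <= r by rewrite divr_ge0// ltW.
have r1 : r < 1 by rewrite ltr_pdivrMr// mul1r.
have H n : f01 a (- (x * r ^+ n)) = 0.
  elim: n => [|n IH]; first by rewrite expr0 mulr1.
  have y0 : 0 <= x * r ^+ n by rewrite mulr_ge0 ?exprn_ge0// ltW.
  have yn0 : x * r ^+ n != 0.
    apply/eqP => y00; move: IH; rewrite y00 oppr0 f010 => /eqP.
    by rewrite oner_eq0.
  have yp : 0 < x * r ^+ n by rewrite lt_def yn0.
  have t0 : - (x * r ^+ n / l') < 0 by rewrite oppr_lt0 divr_gt0.
  have := (e _ t0).2; rewrite !mulrN => H.
  rewrite exprSr mulrA [X in f01 a (- X)](_ : _ = l * (x * r ^+ n / l')).
    apply: H; rewrite -[RHS]IH; congr (f01 a (- _)).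
    by rewrite mulrC divfK// gt_eqF.
  by move: (x * r ^+ n) => q; rewrite /r; field; rewrite gt_eqF.
have : (fun n => f01 a (- (x * r ^+ n))) @ \oo --> f01 a (- (x * 0)).
  apply: continuous_cvg; first exact: continuous_f01.
  apply: cvgN; apply: cvgMr; apply: cvg_expr.
  by rewrite ger0_norm.
rewrite mulr0 oppr0 f010; under eq_fun do rewrite H.
move=> /cvg_lim => /(_ (@Rhausdorff R)); rewrite lim_cst// => /eqP.
by rewrite eq_sym oner_eq0.
Qed.

Lemma f01_product_inj a b c c' l l' m m' s : 0 < a -> 0 < b -> 0 < c -> 0 < c' ->
  0 <= l -> 0 <= l' -> 0 <= m -> 0 <= m' -> 0 < s ->
  (forall t, 0 < t < s ->
    c * (f01 a (l * t) * f01 b (m * (s - t))) =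
    c' * (f01 a (l' * t) * f01 b (m' * (s - t)))) -> l = l'.
Proof.
move=> a0 b0 c0 c'0 l0 l'0 m0 m'0 s0 e.
(* Every argument is put in the form k t + c, even with c = 0, to match [entire_affine]. *)
pose h t := c * (f01 a (l * t + 0) * f01 b (- m * t + m * s)) +
  (- c') * (f01 a (l' * t + 0) * f01 b (- m' * t + m' * s)).
have hE t : h t = c * (f01 a (l * t) * f01 b (m * (s - t))) -
    c' * (f01 a (l' * t) * f01 b (m' * (s - t))).
  rewrite /h !addr0 mulNr !mulrBr !mulNr; congr (_ * (_ * f01 b _) - _ * (_ * f01 b _));
  ring.
have eh : entire h.
  by apply: entireD; apply: entireZ; apply: entireM; apply: entire_affine; exact: entire_f01.
apply: (@f01_root_scale a) => // t t0.
have /eqP : h t = 0.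
  apply: (entire_vanish eh s0) => [y y0|]; last exact: lt_trans s0.
  by rewrite hE e// subrr.
have p n : 0 <= n -> 0 < f01 b (n * (s - t)).
  move=> n0; apply: lt_le_trans ltr01 _; apply: f01_ge1 => //.
  by rewrite mulr_ge0//; lra.
have pm := p _ m0; have pm' := p _ m'0.
have z (k u v : R) : 0 < k -> 0 < v -> k * (u * v) = 0 -> u = 0.
  move=> k0 v0 /eqP.
  by rewrite !mulf_eq0 (gt_eqF k0) (gt_eqF v0) orbF => /eqP.
rewrite hE subr_eq0 => /eqP ht; split => f0; move: ht; rewrite f0 mul0r mulr0.
  by move/esym/(z _ _ _ c'0 pm').
by move/(z _ _ _ c0 pm).
Qed.

End negative_zeros.

(** * The Gamma function *)

Section gamma.
Context {R : realType}.
Implicit Types (a b x : R).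
Local Notation mu := (@lebesgue_measure R).

Definition gamma_kernel a x : R := x `^ (a - 1) * expR (- x).

(** [Gamma] is the [fine] part of this integral and would be 0 if it diverged; the extended value
    keeps finiteness visible until it is proved. *)
Definition egamma a : \bar R := (\int[mu]_(x in `]0%R, +oo[) (gamma_kernel a x)%:E)%E.

Lemma gamma_kernel_ge0 a x : 0 <= gamma_kernel a x.
Proof. by rewrite mulr_ge0 ?powR_ge0 ?expR_ge0. Qed.

Lemma measurable_gamma_kernel a (D : set R) : measurable_fun D (gamma_kernel a).
Proof.
apply: measurable_funTS; apply: measurable_funM.
  exact: measurable_powR.
by apply: measurableT_comp => //.
Qed.

Lemma egamma_ge0 a : (0 <= egamma a)%E.
Proof. by apply: integral_ge0 => x _; rewrite lee_fin gamma_kernel_ge0. Qed.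

(** Only half of the exponent is spent, so that exp(-x) still leaves exp(-x/2) for integrability and
    for the boundary term at infinity. For x > 1, K comes from the Taylor term of order N + 1 >=
    a. *)
Lemma powR_le_expR a : 0 < a ->
  exists2 K, 0 < K & forall x, 0 < x -> x `^ a <= K * expR (x / 2).
Proof.
move=> a0; have [N aN] : exists N : nat, a <= N.+1%:R.
  by exists (Num.truncn a); rewrite ltW// truncnS_gt.
have f1 : 1 <= N.+1`!%:R :> R by rewrite ler1n fact_gt0.
have p1 : 1 <= 2 ^+ N.+1 :> R by rewrite exprn_ege1// ler1n.
have K1 : 1 <= 2 ^+ N.+1 * N.+1`!%:R :> R by rewrite mulr_ege1.
exists (2 ^+ N.+1 * N.+1`!%:R); first exact: lt_le_trans ltr01 K1.
move=> x x0; have [x1|x1] := leP x 1.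
  have : x `^ a <= 1.
    have := @ge0_ler_powR R a (ltW a0) x 1; rewrite powR1 !nnegrE; apply => //.
    exact: ltW.
  move=> /le_trans; apply; rewrite mulr_ege1// ltW// pexpR_gt1// divr_gt0//.
apply: (@le_trans _ _ (x `^ N.+1%:R)); first by rewrite ler_powR// ltW.
rewrite powR_mulrn ?(ltW x0)//.
have -> : x ^+ N.+1 = 2 ^+ N.+1 * N.+1`!%:R * ((x / 2) ^+ N.+1 / N.+1`!%:R).
  rewrite exprMn exprVn; field; rewrite expf_neq0//=; lra.
rewrite ler_wpM2l ?(le_trans ler01 K1)//.
by apply: le_trans (expR_ge1Dxn N _); rewrite ?lerDr// divr_ge0// (ltW x0).
Qed.

(** The shift to a + 1 removes the singularity at 0, and the kernel is then dominated by 2 K times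
    the exponential density of rate 1/2, of mass 1. The functional equation later brings finiteness
    down to a. *)
Lemma egammaS_fin_num a : 0 < a -> egamma (a + 1) \is a fin_num.
Proof.
move=> a0; rewrite ge0_fin_numE ?egamma_ge0//.
have [K K0 HK] := powR_le_expR a0.
have h0 : 0 < 2^-1 :> R by [].
have mp := measurable_exponential_pdf (2^-1 : R).
have p0 := exponential_pdf_ge0 (ltW h0).
apply: (@le_lt_trans _ _ (\int[mu]_(x in `]0%R, +oo[)
    ((2 * K)%:E * (exponential_pdf (2^-1) x)%:E))%E).
  apply: ge0_le_integral => //.
  - by move=> x _; rewrite lee_fin gamma_kernel_ge0.
  - by apply/measurable_EFinP; exact: measurable_gamma_kernel.
  - apply/measurable_EFinP; apply: measurable_funM => //.
    exact: measurable_funTS.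
  - move=> x /=; rewrite in_itv/= andbT => x0.
    rewrite lee_fin exponential_pdfE ?(ltW x0)// /gamma_kernel addrK.
    have -> : expR (- x) = expR (- x / 2) * expR (- x / 2).
      by rewrite -expRD; congr expR; field.
    rewrite (_ : 2 * K * (2^-1 * expR (- 2^-1 * x)) = K * expR (- x / 2)); last first.
      by rewrite mulNr [_^-1 * x]mulrC mulNr; field.
    rewrite mulrA ler_wpM2r ?expR_ge0//.
    by rewrite mulNr expRN ler_pdivrMr ?expR_gt0// HK.
rewrite ge0_integralZl_EFin//; last 3 first.
- by move=> x _; rewrite lee_fin.
- by apply/measurable_EFinP; exact: measurable_funTS.
- by rewrite mulr_ge0// (ltW K0).
apply: lte_mul_pinfty => //; first by rewrite lee_fin mulr_ge0// (ltW K0).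
apply: (@le_lt_trans _ _ 1%E); last exact: ltry.
rewrite -(integral_exponential_pdf h0); apply: ge0_subset_integral => //.
- by apply/measurable_EFinP.
- by move=> x _; rewrite lee_fin.
Qed.

Lemma derivable_LRcontinuous (f : R -> R) a b : a < b ->
  (forall x, a <= x <= b -> derivable f x 1) -> derivable_oo_LRcontinuous f a b.
Proof.
move=> ab fd.
have fc x : a <= x <= b -> {for x, continuous f}.
  by move=> /fd dx; apply: differentiable_continuous; apply/derivable1_diffP.
split.
- by move=> x; rewrite in_itv/= => /andP[/ltW ax /ltW xb]; apply: fd; rewrite ax.
- by apply: cvg_at_right_filter; apply: fc; rewrite lexx ltW.
- by apply: cvg_at_left_filter; apply: fc; rewrite lexx ltW.
Qed.

Lemma egamma_itvS a (p q : R) : 0 < a -> 0 < p < q ->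
  (\int[mu]_(x in `[p, q]) (gamma_kernel (a + 1) x)%:E =
   (p `^ a * expR (- p) - q `^ a * expR (- q))%:E +
   a%:E * \int[mu]_(x in `[p, q]) (gamma_kernel a x)%:E)%E.
Proof.
move=> a0 /andP[p0 pq].
have pos x : p <= x <= q -> 0 < x by move=> /andP[px _]; exact: lt_le_trans px.
have dF x : p <= x <= q -> is_derive x 1 (@powR R ^~ a) (a * x `^ (a - 1)).
  by move=> /pos x0; exact: is_derive1_powR.
have dE x : is_derive x 1 (fun x => expR (- x)) (- expR (- x)).
  by have := is_derive1_comp (is_derive_expR (- x)) (is_deriveNid x 1); rewrite mulrN1.
have dG x : is_derive x 1 (fun x => - expR (- x)) (expR (- x)).
  by have := is_deriveN (dE x); rewrite opprK.
have cts (f : R -> R) (df : R -> R) : (forall x, p <= x <= q -> is_derive x 1 f (df x)) ->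
    {within `[p, q], continuous f}.
  by move=> fd; apply: derivable_within_continuous => x; rewrite in_itv => /fd[].
have := @integration_by_parts R (@powR R ^~ a) (fun x => - expR (- x))
  (fun x => a * x `^ (a - 1)) (fun x => expR (- x)) p q pq.
have -> : (fun x => (x `^ a * expR (- x))%:E) = (fun x => (gamma_kernel (a + 1) x)%:E).
  by apply/funext => x; rewrite /gamma_kernel addrK.
move=> -> //.
- rewrite !mulrN opprK [(- _ + _)%R]addrC; congr (_ + _)%E.
  rewrite -ge0_integralZl_EFin//; last 3 first.
  + by move=> x _; rewrite lee_fin gamma_kernel_ge0.
  + by apply/measurable_EFinP; exact: measurable_gamma_kernel.
  + exact: ltW.
  rewrite -[RHS]oppeK -integral_ge0N/=; last first.
    by move=> x _; rewrite lee_fin mulr_ge0 ?gamma_kernel_ge0 ?(ltW a0).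
  congr (- _)%E; apply: eq_integral => x _.
  by rewrite /gamma_kernel mulrN mulrA.
- apply: (cts _ (fun x => a * ((a - 1) * x `^ (a - 1 - 1)))) => x /pos x0.
  by apply: is_deriveZ; exact: is_derive1_powR.
- by apply: derivable_LRcontinuous => // x /dF[].
- move=> x; rewrite in_itv/= => /andP[/ltW px /ltW xq].
  by rewrite derive1E; have [|_ ->] := dF x; rewrite ?px.
- by apply: cts => x _; exact: dE.
- by apply: derivable_LRcontinuous => // x _; have [] := dG x.
- by move=> x _; rewrite derive1E; have [_ ->] := dG x.
Qed.

(** Starting at 2 makes the endpoints distinct already for n = 0, as the strict inequality in
    [egamma_itvS] demands. *)
Definition exhaust n : set R := `[n.+2%:R^-1, n.+2%:R].

Lemma egamma_cvg a :
  (\int[mu]_(x in exhaust n) (gamma_kernel a x)%:E @[n --> \oo]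
    --> egamma a)%E.
Proof.
rewrite /egamma.
have -> : `]0%R, +oo[%classic = \bigcup_n exhaust n.
  apply/seteqP; rewrite /exhaust; split => x /=.
    rewrite in_itv/= andbT => x0.
    have xV : 0 < x^-1 by rewrite invr_gt0.
    exists (maxn (Num.truncn x) (Num.truncn x^-1)) => //=; rewrite in_itv/=.
    have t1 := truncnS_gt x; have t2 := truncnS_gt x^-1.
    apply/andP; split.
      rewrite -[leRHS]invrK lef_pV2 ?posrE// (le_trans (ltW t2))// ler_nat.
      by rewrite ltnS; exact: leq_trans (leq_maxr _ _) (leqnSn _).
    rewrite (le_trans (ltW t1))// ler_nat ltnS.
    exact: leq_trans (leq_maxl _ _) (leqnSn _).
  move=> [n _]/=; rewrite !in_itv/= andbT => /andP[+ _].
  by apply: lt_le_trans; rewrite invr_gt0.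
apply: ge0_nondecreasing_set_cvg_integral.
- apply/nondecreasing_seqP => n; apply/subsetPset => x; rewrite /exhaust/=.
  rewrite !in_itv/= => /andP[l u]; apply/andP; split.
    by apply: le_trans l; rewrite lef_pV2 ?posrE// ler_nat.
  by apply: le_trans u _; rewrite ler_nat.
- by move=> n; exact: measurable_itv.
- by move=> n; apply/measurable_EFinP; exact: measurable_gamma_kernel.
- by move=> n x _; rewrite lee_fin gamma_kernel_ge0.
Qed.

Lemma invS2_cvg : (n.+2%:R^-1 : R) @[n --> \oo] --> 0^'+.
Proof.
have c0 : (n.+2%:R^-1 : R) @[n --> \oo] --> 0.
  by rewrite (cvg_shiftS (@harmonic R)); exact: cvg_harmonic.
move=> A [e /= e0 eA]; have /cvgrPdist_lt /(_ _ e0) := c0.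
by apply: filterS => n ne; apply: eA => //; rewrite invr_gt0.
Qed.

Lemma halfS2_cvg : (n.+2%:R / 2 : R) @[n --> \oo] --> +oo.
Proof.
apply/cvgryPge => A; near=> n.
rewrite ler_pdivlMr//; apply: (@le_trans _ _ n%:R); last by rewrite ler_nat -addn2 leq_addr.
by near: n; exact: nbhs_infty_ger.
Unshelve. all: by end_near. Qed.

Lemma gamma_boundary_cvg a : 0 < a ->
  (n.+2%:R^-1 `^ a * expR (- n.+2%:R^-1) - n.+2%:R `^ a * expR (- n.+2%:R) : R)
    @[n --> \oo] --> 0.
Proof.
move=> a0; rewrite -[X in _ --> X](subrr 0); apply: cvgB.
  apply: (@squeeze_cvgr _ _ _ _ (cst 0) (fun n => n.+2%:R^-1 `^ a)).
  - near=> n; rewrite mulr_ge0 ?powR_ge0 ?expR_ge0//=.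
    by rewrite ler_piMr ?powR_ge0// expR_le1 oppr_le0.
  - exact: cvg_cst.
  - apply: (@cvg_comp _ _ _ _ (@powR R ^~ a) _ (0^'+)); last exact: powR_cvg0.
    exact: invS2_cvg.
have [K K0 HK] := powR_le_expR a0.
apply: (@squeeze_cvgr _ _ _ _ (cst 0) (fun n => K * expR (- (n.+2%:R / 2)))).
- near=> n; rewrite mulr_ge0 ?powR_ge0 ?expR_ge0//=.
  have -> : - n.+2%:R = - (n.+2%:R / 2) - n.+2%:R / 2 :> R by field.
  rewrite expRD mulrA ler_wpM2r ?expR_ge0//.
  by rewrite expRN ler_pdivrMr ?expR_gt0// HK.
- exact: cvg_cst.
- rewrite -(mulr0 K); apply: cvgMr.
  apply: (@cvg_comp _ _ _ (fun n : nat => n.+2%:R / 2 : R) (fun x => expR (- x)) _ +oo%R).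
    exact: halfS2_cvg.
  exact: cvgr_expR.
Unshelve. all: by end_near. Qed.

(** Integration by parts on the exhausting intervals, whose boundary terms tend to 0. The equation
    lives in the extended reals because the finiteness of [egamma a] is deduced from it. *)
Lemma egammaS a : 0 < a -> egamma (a + 1) = (a%:E * egamma a)%E.
Proof.
move=> a0; rewrite -(cvg_lim (@ereal_hausdorff R) (@egamma_cvg (a + 1))).
apply: cvg_lim => //.
have -> : (fun n : nat => \int[mu]_(x in exhaust n) (gamma_kernel (a + 1) x)%:E)%E =
   (fun n => (n.+2%:R^-1 `^ a * expR (- n.+2%:R^-1) - n.+2%:R `^ a * expR (- n.+2%:R))%:E +
   a%:E * \int[mu]_(x in exhaust n) (gamma_kernel a x)%:E)%E.
  apply/funext => n; apply: egamma_itvS => //.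
  rewrite invr_gt0 ltr0n/= (@lt_trans _ _ 1)// ?ltr1n// invf_lt1 ?ltr1n//.
rewrite -[X in _ --> X]add0e; apply: cvgeD => //.
  by apply: cvg_EFin; [exact: nearW|exact: gamma_boundary_cvg].
by apply: cvgeZl => //; exact: egamma_cvg.
Unshelve. all: by end_near. Qed.

Lemma egamma_fin_num a : 0 < a -> egamma a \is a fin_num.
Proof.
move=> a0; have := egammaS_fin_num a0; rewrite egammaS//.
have := egamma_ge0 a; case: (egamma a) => // _.
by rewrite gt0_muley// lte_fin.
Qed.

Lemma GammaE a : Gamma a = fine (egamma a).
Proof. by []. Qed.

Lemma GammaS a : 0 < a -> Gamma (a + 1) = a * Gamma a.
Proof. by move=> a0; rewrite !GammaE egammaS// fineM// egamma_fin_num. Qed.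

(** For a + 1 the kernel x^a exp(-x) is at least exp(-2) on [1, 2]; the functional equation
    transfers positivity to a. *)
Lemma Gamma_gt0 a : 0 < a -> 0 < Gamma a.
Proof.
move=> a0; have a1 : 0 < a + 1 by rewrite addr_gt0.
rewrite -(pmulr_rgt0 _ a0) -GammaS// GammaE -lte_fin fineK ?egamma_fin_num//.
apply: (@lt_le_trans _ _ (\int[mu]_(x in `[1%R, 2%R]) (cst (expR (- 2))%:E x))%E).
  have m12 : lebesgue_measure (`[1, 2]%classic : set R) = 1%:E.
    by rewrite lebesgue_measure_itv/= lte_fin ltr1n -EFinD; congr EFin; ring.
  rewrite integral_cst// [X in (_ * X)%E]m12 -EFinM mulr1.
  by rewrite lte_fin expR_gt0.
apply: (@le_trans _ _ (\int[mu]_(x in `[1%R, 2%R]) (gamma_kernel (a + 1) x)%:E)%E).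
  apply: ge0_le_integral => //.
  - by move=> x _; rewrite lee_fin expR_ge0.
  - by apply/measurable_EFinP; exact: measurable_gamma_kernel.
  - move=> x /=; rewrite in_itv/= => /andP[x1 x2]; rewrite lee_fin /gamma_kernel addrK.
    rewrite -[leLHS]mul1r ler_pM ?expR_ge0// ?ler_expR ?lerN2//.
    by rewrite -(powRr0 x) ler_powR// ltW.
apply: ge0_subset_integral => //.
- by apply/measurable_EFinP; exact: measurable_gamma_kernel.
- by move=> x _; rewrite lee_fin gamma_kernel_ge0.
- by move=> x /=; rewrite !in_itv/= andbT => /andP[x1 _]; apply: lt_le_trans x1.
Qed.

Lemma poch_rising b i : 0 < b -> poch b i%:R = rising b i.
Proof.
move=> b0; rewrite /poch; apply: (canLR (mulfK _)); first by rewrite gt_eqF// Gamma_gt0.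
elim: i => [|i IH]; first by rewrite addr0 /rising big_ord0 mul1r.
have bi0 : 0 < b + i%:R by rewrite ltr_wpDr.
have -> : b + i.+1%:R = b + i%:R + 1 by rewrite -natr1 addrA.
by rewrite (GammaS bi0) IH risingSr [rising b i * _]mulrC mulrA.
Qed.

Lemma hyp0F1E b x : 0 < b -> hyp0F1 b x = f01 b x.
Proof.
move=> b0; congr (limn (series _)); apply/funext => i.
by rewrite poch_rising//= /f01_coeff invfM mulrAC mulrA.
Qed.

End gamma.

(** * Densities on the simplex *)

Section densities.
Context {R : realType}.

(** A nonnegative integral is a supremum over the simple functions below the integrand, so
    comparison passes through without measurability; [density_le] applies it to functions known to
    be continuous at one point only. *)
Lemma le_integral_nonneg d (T : measurableType d) (mu : {measure set T -> \bar R})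
    (D : set T) (f g : T -> \bar R) :
  (forall x, D x -> (0 <= f x)%E) -> (forall x, D x -> (f x <= g x)%E) ->
  (\int[mu]_(x in D) f x <= \int[mu]_(x in D) g x)%E.
Proof.
move=> f0 fg; have g0 x : D x -> (0 <= g x)%E.
  by move=> Dx; exact: le_trans (f0 _ Dx) (fg _ Dx).
rewrite !ge0_integralE//; apply: ereal_sup_le => _ [h /= hf <-].
exists h => //= x; apply: le_trans (hf x) _.
rewrite !patchE; case: ifPn => //; rewrite inE; exact: fg.
Qed.

(** Tuples carry the sigma-algebra and the measure, row vectors the topology; continuity on tuples
    is expressed through this map. *)
Definition tuple_of_rV n (v : 'rV[R]_n) : n.-tuple R := [tuple v ord0 i | i < n].

Lemma tuple_of_rVK n (t : n.-tuple R) : tuple_of_rV (\row_i tnth t i) = t.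
Proof. by apply: eq_from_tnth => i; rewrite tnth_mktuple mxE. Qed.

(** If g exceeded f at the point, levels p < q would separate them on a small box, and equal
    integrals over it would give q <= p, the box having positive finite measure. *)
Lemma density_le n (S : set (n.-tuple R)) (f g : n.-tuple R -> R) (v0 : 'rV[R]_n) :
  (forall x, S x -> 0 <= f x) -> (forall x, S x -> 0 <= g x) ->
  (\forall v \near v0, S (tuple_of_rV v)) ->
  {for v0, continuous (f \o @tuple_of_rV n)} ->
  {for v0, continuous (g \o @tuple_of_rV n)} ->
  (forall A, measurable A ->
    (\int[lebesgue_tuple n]_(x in A `&` S) (f x)%:E =
     \int[lebesgue_tuple n]_(x in A `&` S) (g x)%:E)%E) ->
  g (tuple_of_rV v0) <= f (tuple_of_rV v0).
Proof.
move=> f0 g0 nS cf cg fg; rewrite leNgt; apply/negP => lt_fg.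
set x0 := tuple_of_rV v0 in lt_fg.
pose p := (2 * f x0 + g x0) / 3; pose q := (f x0 + 2 * g x0) / 3.
have fp : f x0 < p by rewrite /p; lra.
have pq : p < q by rewrite /p /q; lra.
have qg : q < g x0 by rewrite /q; lra.
have nf : \forall v \near v0, f (tuple_of_rV v) < p by exact: (cvgr_lt _ cf).
have ng : \forall v \near v0, q < g (tuple_of_rV v) by exact: (cvgr_gt _ cg).
have /nbhs_ballP[e /= e0 He] : \forall v \near v0,
    [/\ S (tuple_of_rV v), f (tuple_of_rV v) < p & q < g (tuple_of_rV v)].
  by near=> v; split; near: v.
(* Balls of row vectors are taken coordinatewise, hence are boxes, measured by
   [lebesgue_tuple_box]. *)
pose I (i : 'I_n) : set R := ball (v0 ord0 i) e.
pose A : set (n.-tuple R) := [set t | forall i, I i (tnth t i)].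
have AH t : A t -> [/\ S t, f t < p & q < g t].
  move=> At; rewrite -(tuple_of_rVK t); apply: He; split => // i j.
  by rewrite mxE (ord1 i); exact: At.
have mI i : measurable (I i) by exact: measurable_ball.
have mA : measurable A.
  have -> : A = \bigcap_(i in [set: 'I_n]) [set t | I i (tnth t i)].
    by apply/seteqP; split => [t At i _|t At i]; exact: At.
  apply: fin_bigcap_measurable => // i _.
  by rewrite -[X in measurable X]setTI; exact: measurable_tnth.
have muA : lebesgue_tuple n A = (\prod_(i < n) (e *+ 2))%:E.
  rewrite lebesgue_tuple_box// -prodEFin; apply: eq_bigr => i _.
  by rewrite lebesgue_measure_ball// ltW.
have mu0 : 0 < \prod_(i < n) (e *+ 2) by apply: prodr_gt0 => i _; rewrite mulrn_wgt0.
have AS : A `&` S = A by apply/setIidPl => t /AH[].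
have := fg A mA; rewrite AS => E.
have : (q%:E * lebesgue_tuple n A <= p%:E * lebesgue_tuple n A)%E.
  rewrite -!integral_cst//.
  apply: (@le_trans _ _ (\int[lebesgue_tuple n]_(x in A) (g x)%:E)%E).
    apply: le_integral_nonneg => x /AH[Sx _ qgx]; rewrite lee_fin.
      have [Sx0 _ _] := He _ (ballxx v0 e0).
      exact: le_trans (f0 _ Sx0) (ltW (lt_trans fp pq)).
    exact: ltW.
  rewrite -E; apply: le_integral_nonneg => x /AH[Sx fxp _]; rewrite lee_fin.
    exact: f0.
  exact: ltW.
by rewrite muA -!EFinM lee_fin ler_pM2r// leNgt pq.
Unshelve. all: by end_near. Qed.

Lemma density_eq n (S : set (n.-tuple R)) (f g : n.-tuple R -> R) (v0 : 'rV[R]_n) :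
  (forall x, S x -> 0 <= f x) -> (forall x, S x -> 0 <= g x) ->
  (\forall v \near v0, S (tuple_of_rV v)) ->
  {for v0, continuous (f \o @tuple_of_rV n)} ->
  {for v0, continuous (g \o @tuple_of_rV n)} ->
  (forall A, measurable A ->
    (\int[lebesgue_tuple n]_(x in A `&` S) (f x)%:E =
     \int[lebesgue_tuple n]_(x in A `&` S) (g x)%:E)%E) ->
  f (tuple_of_rV v0) = g (tuple_of_rV v0).
Proof.
move=> f0 g0 nS cf cg fg; apply/eqP; rewrite eq_le.
apply/andP; split; apply: (@density_le n S) => // A mA.
by rewrite fg.
Qed.

End densities.

(** * Completed coordinates on the simplex *)

Section simplex.
Context {R : realType}.
Variable D : nat.
Implicit Types (x : D.-tuple R) (z : 'I_D.+1 -> R).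

Lemma tnth_complete x (i : 'I_D.+1) : tnth (complete x) i =
  if unlift ord_max i is Some j then tnth x j else 1 - \sum_(j < D) tnth x j.
Proof.
rewrite (tnth_nth 0) /= nth_rcons size_tuple.
case: unliftP => [j ->|->]; last by rewrite ltnn eqxx.
by rewrite lift_max ltn_ord (tnth_nth 0).
Qed.

(** This allows a point of the simplex to be prescribed by all its D + 1 coordinates
    symmetrically. *)
Lemma completeK z : \sum_i z i = 1 ->
  forall i, tnth (complete [tuple z (lift ord_max j) | j < D]) i = z i.
Proof.
move=> z1 i; rewrite tnth_complete.
case: unliftP => [j ->|->]; first by rewrite tnth_mktuple.
rewrite -z1 big_ord_recr/= [X in _ - X](eq_bigr (fun j => z (widen_ord (leqnSn D) j))).
  by rewrite addrAC subrr add0r.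
move=> j _; rewrite tnth_mktuple; congr z.
by apply/ord_inj; rewrite lift_max.
Qed.

Lemma open_simplexP x : @open_simplex R D x <-> forall i, 0 < tnth (complete x) i.
Proof.
split=> [[x01 x1] i|x0].
  rewrite tnth_complete; case: unliftP => [j _|_]; last by rewrite subr_gt0.
  by have /andP[] := x01 j.
have xi j : 0 < tnth x j by have := x0 (lift ord_max j); rewrite tnth_complete liftK.
have x1 : \sum_(i < D) tnth x i < 1.
  by have := x0 ord_max; rewrite tnth_complete unlift_none subr_gt0.
split => // i; rewrite xi; apply: le_lt_trans x1.
by rewrite (bigD1 i)//= lerDl sumr_ge0// => j _; exact: ltW.
Qed.

Lemma complete_cvg T (F : set_system T) {FF : Filter F} (u : T -> D.-tuple R) x
    (i : 'I_D.+1) :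
  (forall j, tnth (u t) j @[t --> F] --> tnth x j) ->
  tnth (complete (u t)) i @[t --> F] --> tnth (complete x) i.
Proof.
move=> ux; under eq_cvg do rewrite tnth_complete.
rewrite tnth_complete; case: unlift => [j|]; first exact: ux.
apply: cvgB; first exact: cvg_cst.
by apply: cvg_big => [|j _]; [exact: add_continuous|exact: ux].
Qed.

Lemma tnth_tuple_of_rV_cvg (v0 : 'rV[R]_D) j :
  tnth (tuple_of_rV v) j @[v --> v0] --> tnth (tuple_of_rV v0) j.
Proof.
under eq_cvg do rewrite tnth_mktuple.
by rewrite tnth_mktuple; exact: coord_continuous.
Qed.

Lemma near_open_simplex (v0 : 'rV[R]_D) : @open_simplex R D (tuple_of_rV v0) ->
  \forall v \near v0, @open_simplex R D (tuple_of_rV v).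
Proof.
move=> /open_simplexP S0; near=> v; apply/open_simplexP.
near: v; apply: filter_forall => i.
have c := complete_cvg (i := i) (@tnth_tuple_of_rV_cvg v0).
exact: (cvgr_gt _ (c _) _ (S0 i)).
Unshelve. all: by end_near. Qed.

End simplex.

(** * Factorisation and continuity of the density, and recovery of the exponents *)

Section pdf.
Context {R : realType}.
Implicit Types (a b l m s t : R).

Definition pdf_factor a l t : R := t `^ (a - 1) * f01 a (l * t).

Definition pdf_const D (alpha lambda : D.+1.-tuple R) : R :=
  Gamma (tsum alpha) / \prod_(i < D.+1) Gamma (tnth alpha i)
  / hyp0F1 (tsum alpha) (tsum lambda / 4).

Lemma pdf_factor_gt0 a l t : 0 < a -> 0 <= l -> 0 < t -> 0 < pdf_factor a l t.
Proof.
move=> a0 l0 t0; rewrite mulr_gt0 ?powR_gt0//.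
by rewrite (lt_le_trans ltr01)// f01_ge1// mulr_ge0// ltW.
Qed.

Lemma continuous_f01M a l : 0 < a -> continuous (fun t => f01 a (l * t)).
Proof.
move=> a0 t; apply: continuous_comp; first exact: mulrl_continuous.
exact: continuous_f01.
Qed.

Lemma pdf_factor_continuous a l t : 0 < a -> 0 < t ->
  {for t, continuous (pdf_factor a l)}.
Proof.
move=> a0 t0; apply: (@continuousM _ _ (@powR R ^~ (a - 1))); last exact: continuous_f01M.
exact: is_derive_continuous (is_derive1_powR _ t0).
Qed.

Section parameters.
Variables (D : nat) (alpha lambda : D.+1.-tuple R).
Hypothesis alpha0 : forall i, 0 < tnth alpha i.
Hypothesis lambda0 : forall i, 0 <= tnth lambda i.

Let factor i : R -> R := pdf_factor (tnth alpha i) (tnth lambda i / 4).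

Lemma cncdir_pdfE x : cncdir_pdf alpha lambda x =
  pdf_const alpha lambda * \prod_i factor i (tnth (complete x) i).
Proof.
rewrite /cncdir_pdf /pdf_const /factor /pdf_factor big_split/=.
rewrite (eq_bigr _ (fun i _ => hyp0F1E _ (alpha0 i))); ring.
Qed.

Lemma pdf_const_gt0 : 0 < pdf_const alpha lambda.
Proof.
have ta : 0 < tsum alpha.
  by rewrite /tsum big_ord_recl ltr_pwDl// sumr_ge0// => i _; exact: ltW.
rewrite /pdf_const hyp0F1E// !divr_gt0 ?Gamma_gt0//.
  by apply: prodr_gt0 => i _; exact: Gamma_gt0.
by rewrite (lt_le_trans ltr01)// f01_ge1// divr_ge0// sumr_ge0.
Qed.

Lemma factor_gt0 i t : 0 < t -> 0 < factor i t.
Proof. by move=> t0; apply: pdf_factor_gt0 => //; rewrite divr_ge0. Qed.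

Lemma cncdir_pdf_ge0 x : open_simplex x -> 0 <= cncdir_pdf alpha lambda x.
Proof.
move=> /open_simplexP x0; rewrite cncdir_pdfE mulr_ge0 ?ltW ?pdf_const_gt0//.
by apply: prodr_gt0 => i _; exact: factor_gt0.
Qed.

Lemma cncdir_pdf_cvg T (F : set_system T) {FF : Filter F} (u : T -> D.-tuple R) x :
  (forall j, tnth (u t) j @[t --> F] --> tnth x j) -> open_simplex x ->
  cncdir_pdf alpha lambda (u t) @[t --> F] --> cncdir_pdf alpha lambda x.
Proof.
move=> ux /open_simplexP x0; under eq_cvg do rewrite cncdir_pdfE.
rewrite cncdir_pdfE; apply: cvgMr.
apply: cvg_big => [|i _]; first exact: mul_continuous.
apply: continuous_cvg; first exact: pdf_factor_continuous.
exact: complete_cvg.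
Qed.

Lemma cncdir_pdf_continuous (v0 : 'rV[R]_D) : open_simplex (tuple_of_rV v0) ->
  {for v0, continuous (cncdir_pdf alpha lambda \o @tuple_of_rV R D)}.
Proof.
move=> S0; exact: (cncdir_pdf_cvg (FF := nbhs_filter v0) (@tnth_tuple_of_rV_cvg R D v0) S0).
Qed.

End parameters.

Lemma cncdir_pdf_inj D (alpha lambda alpha' lambda' : D.+1.-tuple R) x :
  (forall i, 0 < tnth alpha i) -> (forall i, 0 < tnth alpha' i) ->
  (forall i, 0 <= tnth lambda i) -> (forall i, 0 <= tnth lambda' i) ->
  (forall A, measurable A ->
    (\int[lebesgue_tuple D]_(x in A `&` @open_simplex R D)
       (cncdir_pdf alpha lambda x)%:E =
     \int[lebesgue_tuple D]_(x in A `&` @open_simplex R D)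
       (cncdir_pdf alpha' lambda' x)%:E)%E) ->
  open_simplex x -> cncdir_pdf alpha lambda x = cncdir_pdf alpha' lambda' x.
Proof.
move=> a0 a'0 l0 l'0 e; rewrite -(tuple_of_rVK x) => xS.
apply: (@density_eq _ _ (@open_simplex R D)) => //.
- exact: cncdir_pdf_ge0.
- exact: cncdir_pdf_ge0.
- exact: near_open_simplex.
- exact: cncdir_pdf_continuous.
- exact: cncdir_pdf_continuous.
Qed.

(** If a < a', dividing by t^(a-1) gives U(t) = t^(a'-a) V(t), which tends to 0 as t decreases to 0,
    against U(0) > 0. Exchanging the two sides yields the reverse inequality. *)
Lemma powR_exponent_le a a' s (U V : R -> R) : 0 < s ->
  {for 0, continuous U} -> {for 0, continuous V} -> 0 < U 0 ->
  (forall t, 0 < t < s -> t `^ (a - 1) * U t = t `^ (a' - 1) * V t) ->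
  a' <= a.
Proof.
move=> s0 cU cV U0 e; rewrite leNgt; apply/negP => aa'.
have c1 : U t @[t --> 0^'+] --> U 0 by exact: cvg_at_right_filter.
have c2 : t `^ (a' - a) * V t @[t --> 0^'+] --> 0 * V 0.
  apply: cvgM; last exact: cvg_at_right_filter.
  by apply: powR_cvg0; rewrite subr_gt0.
have : U 0 = 0 * V 0.
  apply: (cvg_unique _ c1) => //.
  apply: cvg_trans c2; apply: near_eq_cvg; near=> t.
  have t0 : 0 < t by [].
  have ts : t < s by near: t; exact: nbhs_right_lt.
  have := e t; rewrite t0 ts => /(_ isT) et.
  have p0 : t `^ (a - 1) != 0 by rewrite gt_eqF ?powR_gt0.
  apply/(mulfI p0); rewrite et mulrA -powRD; last by rewrite (gt_eqF t0) implybT.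
  by congr (_ `^ _ * _); ring.
by move/eqP; rewrite mul0r gt_eqF.
Unshelve. all: by end_near. Qed.

(** Everything but the power of t is collected in U, which is continuous at 0 because s - t stays
    near s > 0, and positive there because F(a; 0) = 1. *)
Lemma pdf_factor_inj a b a' b' l m l' m' c c' s :
  0 < a -> 0 < b -> 0 < a' -> 0 < b' -> 0 <= l -> 0 <= m -> 0 <= l' -> 0 <= m' ->
  0 < c -> 0 < c' -> 0 < s ->
  (forall t, 0 < t < s ->
    c * (pdf_factor a l t * pdf_factor b m (s - t)) =
    c' * (pdf_factor a' l' t * pdf_factor b' m' (s - t))) -> a = a'.
Proof.
move=> a0 b0 a'0 b'0 l0 m0 l'0 m'0 c0 c'0 s0 e.
pose U (c a l b m : R) t := c * (f01 a (l * t) * pdf_factor b m (s - t)).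
have cU k u n v w : 0 < u -> 0 < v -> {for 0, continuous (U k u n v w)}.
  move=> u0 v0; apply: cvgMr; apply: cvgM; first exact: continuous_f01M.
  apply: continuous_cvg.
    by apply: pdf_factor_continuous; rewrite ?subr0.
  by apply: cvgB; [exact: cvg_cst|exact: cvg_id].
have U0 k u n v w : 0 < k -> 0 < u -> 0 <= n -> 0 < v -> 0 <= w -> 0 < U k u n v w 0.
  move=> k0 u0 n0 v0 w0; rewrite /U mulr0 f010 mul1r subr0 mulr_gt0//.
  exact: pdf_factor_gt0.
have E t : 0 < t < s ->
    t `^ (a - 1) * U c a l b m t = t `^ (a' - 1) * U c' a' l' b' m' t.
  move=> /e et; rewrite /U.
  by rewrite mulrCA [in RHS]mulrCA 2![_ `^ _ * (f01 _ _ * _)]mulrA.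
apply/eqP; rewrite eq_le; apply/andP; split.
  by apply: powR_exponent_le s0 (cU c' a' l' b' m' _ _) (cU c a l b m _ _) _ _;
    rewrite ?U0// => t /E.
by apply: powR_exponent_le s0 (cU c a l b m _ _) (cU c' a' l' b' m' _ _) _ E;
  rewrite ?U0.
Qed.

End pdf.

(** * Identification of the parameters *)

Section identification.
Context {R : realType}.
Variable D : nat.
Variables (alpha lambda alpha' lambda' : D.+1.-tuple R).
Hypotheses (alpha0 : forall i, 0 < tnth alpha i) (alpha'0 : forall i, 0 < tnth alpha' i).
Hypotheses (lambda0 : forall i, 0 <= tnth lambda i) (lambda'0 : forall i, 0 <= tnth lambda' i).

(** The edges pass through the barycentre, all of whose coordinates are w; coordinates i and k share
    the total w + w, which is the s of the one-variable lemmas. *)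
Let w : R := D.+1%:R^-1.

Let edge (i k : 'I_D.+1) t j : R := if j == i then t else if j == k then w + w - t else w.

Let w_gt0 : 0 < w. Proof. by rewrite invr_gt0. Qed.

Let sum_edge i k t : k != i -> \sum_j edge i k t j = 1.
Proof.
move=> ki; have : \sum_(j < D.+1) w = 1.
  by rewrite sumr_const card_ord -mulr_natr mulVf// pnatr_eq0.
rewrite (bigD1 i)//= (bigD1 k)//= => <-.
rewrite (bigD1 i)//= (bigD1 k)//= /edge !eqxx (negbTE ki).
rewrite [X in _ + (_ + X)](eq_bigr (fun=> w)) => [|j /andP[/negbTE -> /negbTE ->]//].
ring.
Qed.

(** The constant absorbs the normalisation and the factors of all coordinates that stay at w. *)
Let edge_pdf (i k : 'I_D.+1) (a l : D.+1.-tuple R) : k != i ->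
  (forall i, 0 < tnth a i) -> (forall i, 0 <= tnth l i) ->
  exists2 c, 0 < c & forall t,
    cncdir_pdf a l [tuple edge i k t (lift ord_max j) | j < D] =
    c * (pdf_factor (tnth a i) (tnth l i / 4) t *
         pdf_factor (tnth a k) (tnth l k / 4) (w + w - t)).
Proof.
move=> ki a0 l0.
exists (pdf_const a l *
  \prod_(j < D.+1 | (j != i) && (j != k)) pdf_factor (tnth a j) (tnth l j / 4) w).
  rewrite mulr_gt0 ?pdf_const_gt0//; apply: prodr_gt0 => j _.
  exact: factor_gt0.
move=> t; rewrite cncdir_pdfE//.
under eq_bigr do rewrite (completeK (sum_edge t ki)).
rewrite (bigD1 i)//= (bigD1 k)//= /edge !eqxx (negbTE ki).
rewrite [X in _ * (_ * (_ * X))](eq_bigr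
  (fun j => pdf_factor (tnth a j) (tnth l j / 4) w)) => [|j /andP[/negbTE -> /negbTE ->]//].
ring.
Qed.

Lemma cncdir_pdf_param_eq : (1 <= D)%N ->
  (forall x, open_simplex x -> cncdir_pdf alpha lambda x = cncdir_pdf alpha' lambda' x) ->
  alpha = alpha' /\ lambda = lambda'.
Proof.
move=> D1 e.
(* The assumption 1 <= D enters here: an edge needs two distinct coordinates. *)
have other (i : 'I_D.+1) : exists k : 'I_D.+1, k != i.
  have [->|i0] := eqVneq i ord0; last by exists ord0; rewrite eq_sym.
  by exists ord_max; rewrite -val_eqE/= -lt0n.
have s0 : 0 < w + w by rewrite addr_gt0.
have eq_pair i k : k != i -> exists c c', [/\ 0 < c, 0 < c' & forall t, 0 < t < w + w ->
    c * (pdf_factor (tnth alpha i) (tnth lambda i / 4) t *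
         pdf_factor (tnth alpha k) (tnth lambda k / 4) (w + w - t)) =
    c' * (pdf_factor (tnth alpha' i) (tnth lambda' i / 4) t *
         pdf_factor (tnth alpha' k) (tnth lambda' k / 4) (w + w - t))].
  move=> ki; have [c c0 ec] := edge_pdf ki alpha0 lambda0.
  have [c' c'0 ec'] := edge_pdf ki alpha'0 lambda'0.
  exists c, c'; split => // t /andP[t0 ts]; rewrite -ec -ec'; apply: e.
  apply/open_simplexP => j; rewrite (completeK (sum_edge t ki)) /edge.
  by do 2?[case: ifP => // _]; rewrite subr_gt0.
have q0 (l : R) : 0 <= l -> 0 <= l / 4 by move=> l0; rewrite divr_ge0.
have aE i : tnth alpha i = tnth alpha' i.
  have [k /eq_pair[c [c' [c0 c'0 ec]]]] := other i.
  apply: pdf_factor_inj (alpha0 i) (alpha0 k) (alpha'0 i) (alpha'0 k) _ _ _ _ c0 c'0 s0 ec;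
  exact: q0.
split; apply: eq_from_tnth => // i.
have [k /eq_pair[c [c' [c0 c'0 ec]]]] := other i.
suff : tnth lambda i / 4 = tnth lambda' i / 4 by apply: mulIf; rewrite invr_eq0.
apply: (f01_product_inj (alpha0 i) (alpha0 k) c0 c'0 _ _ (q0 _ (lambda0 k))
  (q0 _ (lambda'0 k)) s0); rewrite ?q0// => t ts.
(* By [aE], at i as well as at k, the powers of t and of s - t agree on both sides and cancel,
   leaving the products of 0F1 factors. *)
have := ec t ts; rewrite -!aE /pdf_factor; case/andP: ts => t0 ts.
set u := t `^ _; set v := (_ - t) `^ _ => E.
have u0 : u != 0 by rewrite gt_eqF// powR_gt0.
have v0 : v != 0 by rewrite gt_eqF// powR_gt0// subr_gt0.
apply: (mulfI u0); apply: (mulfI v0).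
by transitivity (c * (u * f01 (tnth alpha i) (tnth lambda i / 4 * t) *
  (v * f01 (tnth alpha k) (tnth lambda k / 4 * (w + w - t))))); [ring|rewrite E; ring].
Qed.

End identification.

Theorem proposition3p16 (R : realType) (D : nat) (hD : (1 <= D)%N)
    (alpha lambda alpha' lambda' : D.+1.-tuple R)
    (halpha : forall i, 0 < tnth alpha i)
    (halpha' : forall i, 0 < tnth alpha' i)
    (hlambda : forall i, 0 <= tnth lambda i)
    (hlambda' : forall i, 0 <= tnth lambda' i)
    (d d' : measure_display)
    (Omega : measurableType d) (Omega' : measurableType d')
    (P : probability Omega R) (P' : probability Omega' R)
    (X : {RV P >-> (D.-tuple R)}) (X' : {RV P' >-> (D.-tuple R)})
    (hX : is_cncdir alpha lambda (distribution P X))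
    (hX' : is_cncdir alpha' lambda' (distribution P' X')) :
  same_distribution X X' <-> alpha = alpha' /\ lambda = lambda'.
Proof.
split=> [XX'|[aE lE] A mA].
  apply: (cncdir_pdf_param_eq halpha halpha' hlambda hlambda' hD) => x.
  apply: (cncdir_pdf_inj halpha halpha' hlambda hlambda') => A mA.
  exact: etrans (esym (hX A mA)) (etrans (XX' A mA) (hX' A mA)).
move: hX'; rewrite -aE -lE => hX'.
exact: etrans (hX A mA) (esym (hX' A mA)).
Qed.
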